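(* A metric associated to a normal contact pair with decomposable endomorphism cannot be flat. That is, if $(\alpha_1,\alpha_2,\phi)$ is a normal contact pair structure on a manifold $M$ with decomposable $\phi$, and $g$ is a metric associated to it, then $g$ is not flat.
   Context: All objects are smooth. The exterior derivative of a 1-form is normalized by $2\,d\alpha(X,Y)=X\alpha(Y)-Y\alpha(X)-\alpha([X,Y])$. Contact pair of type $(h,k)$ ($h,k\ge 0$ integers) on a $(2h+2k+2)$-dimensional manifold $M$: a pair of 1-forms $(\alpha_1,\alpha_2)$ such that $\alpha_1\wedge(d\alpha_1)^h\wedge\alpha_2\wedge(d\alpha_2)^k$ is a volume form, $(d\alpha_1)^{h+1}=0$ and $(d\alpha_2)^{k+1}=0$. A contact pair is a contact pair of some type $(h,k)$. The Reeb vector fields $Z_1,Z_2$ are the unique vector fields with $\alpha_i(Z_j)=\delta_{ij}$ and $i_{Z_j}d\alpha_i=0$ for all $i,j\in\{1,2\}$. The distribution $T\mathcal{F}_i=\ker\alpha_i\cap\ker d\alpha_i$ is integrable and defines the characteristic foliation $\mathcal{F}_i$ of $\alpha_i$; $TM=T\mathcal{F}_1\oplus T\mathcal{F}_2$. A contact pair structure $(\alpha_1,\alpha_2,\phi)$ consists of a contact pair $(\alpha_1,\alpha_2)$ and a $(1,1)$-tensor field (endomorphism field) $\phi$ with $\phi^2=-\mathrm{Id}+\alpha_1\otimes Z_1+\alpha_2\otimes Z_2$ and $\phi Z_1=\phi Z_2=0$. The endomorphism $\phi$ is decomposable if $\phi(T\mathcal{F}_i)\subset T\mathcal{F}_i$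 for $i=1,2$. The structure is normal if the tensor $N^1(X,Y)=[\phi,\phi](X,Y)+2d\alpha_1(X,Y)Z_1+2d\alpha_2(X,Y)Z_2$ vanishes, where $[\phi,\phi](X,Y)=\phi^2[X,Y]+[\phi X,\phi Y]-\phi[\phi X,Y]-\phi[X,\phi Y]$ is the Nijenhuis tensor of $\phi$; equivalently, the two almost complex structures $\phi\pm(\alpha_1\otimes Z_2-\alpha_2\otimes Z_1)$ are integrable. A Riemannian metric $g$ on $M$ is associated to $(\alpha_1,\alpha_2,\phi)$ if $g(X,\phi Y)=(d\alpha_1+d\alpha_2)(X,Y)$ and $g(X,Z_i)=\alpha_i(X)$ for $i=1,2$ and all vector fields $X,Y$. Flat means that the Riemann curvature tensor vanishes identically.
   Formalization: The manifold is assumed nonempty and type (h,k) = (0,0) is excluded: there both forms are closed, phi = 0 and the associated metric is always flat (e.g. dx, dy on the 2-torus with dx^2+dy^2), so the claim fails for that type. *)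

(* Defs.v *)
From HB Require Import structures.
From mathcomp Require Import all_boot all_order perm all_algebra.
From mathcomp Require Import all_classical all_reals all_analysis.
From mathcomp Require Import ring.
Import numFieldNormedType.Exports.
Import Order.TTheory GRing.Theory Num.Theory.
Set Implicit Arguments.
Unset Strict Implicit.
Unset Printing Implicit Defensive.
Local Open Scope classical_set_scope.
Local Open Scope ring_scope.

(* Smooth manifolds are Hausdorff second countable spaces with a smooth atlas.
   Tensor calculus is the usual algebraic one over the ring Cinf of smooth
   functions: vector fields are the derivations of Cinf, and tensor fields are
   the Cinf-multilinear maps on vector fields. *)

Section Smooth.
Context {R : realType} {V W : normedModType R}.

(* Only meaningful for an open set A. *)
Fixpoint Ck_on (k : nat) (A : set V) (f : V -> W) : Prop :=
  match k with
  | 0 => forall x, A x -> {for x, continuous f}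
  | k'.+1 => (forall x, A x -> differentiable f x) /\
             (forall v, Ck_on k' A (fun x => 'D_v f x))
  end.

Definition smooth_on (A : set V) (f : V -> W) : Prop := forall k, Ck_on k A f.

Lemma near_eq_differentiable (f g : V -> W) x :
  (\near x, f x = g x) -> differentiable f x -> differentiable g x.
Proof.
move=> fg df.
pose h := g - f.
have h0 : \near x, h x = 0.
  by near=> y; rewrite /h /= fctE -(near fg y) ?subrr.
have hx : h \o shift x = cst (h x) + \0 +o_ 0 id.
  apply/eqaddoP => _/posnumP[e]; near=> y.
  rewrite !fctE /= (nbhs_singleton h0) !addr0 subr0 (_ : h _ = 0) ?normr0 ?mulr_ge0//.
  by near: y; move: h0; rewrite (near_shift 0) subr0; exact: filterS.
have dh : differentiable h x.
  have d0 := @diff_unique _ _ _ h \0 x (@cst_continuous _ _ 0) hx.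
  by apply/diff_locallyP; rewrite d0; split; first exact: cst_continuous.
have -> : g = f + h by rewrite /h addrC subrK.
exact: differentiableD.
Unshelve. all: by end_near. Qed.

Lemma Ck_on_ext k (A : set V) (f g : V -> W) : open A ->
  (forall x, A x -> f x = g x) -> Ck_on k A f -> Ck_on k A g.
Proof.
move=> oA; elim: k f g => [|k IH] f g fg.
  move=> cf x Ax; have := cf x Ax.
  rewrite /prop_for /continuous_at -(fg x Ax); apply: cvg_trans.
  apply: near_eq_cvg; have : \near x, A x by exact: open_nbhs_nbhs.
  by apply: filterS.
move=> [df Df]; have nfg x (Ax : A x) : \near x, f x = g x.
  by have : \near x, A x by [exact: open_nbhs_nbhs]; apply: filterS.
split=> [x Ax|v]; first by apply: near_eq_differentiable (df x Ax); exact: nfg.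
by apply: IH (Df v) => x Ax; exact/near_eq_derive/nfg.
Qed.

Lemma Ck_onW k (A : set V) (f : V -> W) : Ck_on k.+1 A f -> Ck_on k A f.
Proof.
elim: k f => [|k IH] f [df Df].
  by move=> x Ax; exact/differentiable_continuous/df.
by split=> // v; exact/IH/Df.
Qed.

Lemma Ck_on_cst k (A : set V) (a : W) : open A -> Ck_on k A (cst a).
Proof.
move=> oA; elim: k a => [a x _|k IH a]; first exact: cst_continuous.
split=> // v; apply: Ck_on_ext (IH 0) => // x _.
by rewrite derive_cst.
Qed.

Lemma Ck_onD k (A : set V) (f g : V -> W) : open A ->
  Ck_on k A f -> Ck_on k A g -> Ck_on k A (f + g).
Proof.
move=> oA; elim: k f g => [f g cf cg x Ax|k IH f g [df Df] [dg Dg]].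
  by apply: continuousD; [exact: cf|exact: cg].
split=> [x Ax|v]; first by apply: differentiableD; [exact: df|exact: dg].
apply: Ck_on_ext (IH _ _ (Df v) (Dg v)) => // x Ax.
by rewrite deriveD //; [exact/diff_derivable/df|exact/diff_derivable/dg].
Qed.
End Smooth.

Lemma Ck_onM (R : realType) (V : normedModType R) k (A : set V)
    (f g : V -> R^o) : open A ->
  Ck_on k A f -> Ck_on k A g -> Ck_on k A (f * g).
Proof.
move=> oA; elim: k f g => [f g cf cg x Ax|k IH f g sf sg].
  by apply: (@continuousM R); [exact: cf|exact: cg].
have [[df Df] [dg Dg]] := (sf, sg).
split=> [x Ax|v]; first by apply: differentiableM; [exact: df|exact: dg].
pose h := f * (fun x => 'D_v g x) + g * (fun x => 'D_v f x).
apply: (@Ck_on_ext _ _ _ _ _ h) => //.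
  by move=> x Ax; rewrite deriveM //; [exact/diff_derivable/df|exact/diff_derivable/dg].
apply: Ck_onD => //.
  exact: IH (Ck_onW sf) (Dg v).
exact: IH (Ck_onW sg) (Df v).
Qed.

Record chart (R : realType) (n : nat) (M : topologicalType) := Chart {
  chart_dom : set M;
  chart_img : set 'rV[R]_n;
  chart_map : M -> 'rV[R]_n;
  chart_inv : 'rV[R]_n -> M;
  chart_dom_open : open chart_dom;
  chart_img_open : open chart_img;
  chart_mapP : forall p, chart_dom p -> chart_img (chart_map p);
  chart_invP : forall u, chart_img u -> chart_dom (chart_inv u);
  chart_mapK : forall p, chart_dom p -> chart_inv (chart_map p) = p;
  chart_invK : forall u, chart_img u -> chart_map (chart_inv u) = u;
  chart_map_continuous : forall p, chart_dom p -> {for p, continuous chart_map};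
  chart_inv_continuous : forall u, chart_img u -> {for u, continuous chart_inv}
}.

Record manifold (R : realType) (n : nat) := Manifold {
  manifold_carrier :> topologicalType;
  manifold_hausdorff : hausdorff_space manifold_carrier;
  manifold_second_countable : @second_countable manifold_carrier;
  atlas : set (chart R n manifold_carrier);
  atlas_cover : forall p, exists2 c, atlas c & chart_dom c p;
  atlas_compatible : forall c d, atlas c -> atlas d ->
    smooth_on (chart_img c `&` chart_inv c @^-1` chart_dom d)
              (chart_map d \o chart_inv c)
}.

Section SmoothFunctions.
Context {R : realType} {n : nat} (M : manifold R n).

Definition is_smooth (f : M -> R^o) : Prop :=
  forall c, atlas c -> smooth_on (chart_img c) (f \o chart_inv c).

Definition smooth_pred : {pred M -> R^o} := fun f => `[< is_smooth f >].

Lemma smooth_pred_subring : subring_closed smooth_pred.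
Proof.
split=> [|f g /asboolP sf /asboolP sg|f g /asboolP sf /asboolP sg];
  apply/asboolP => c cA k.
- by apply: Ck_on_cst; exact: chart_img_open.
- have oc : open (chart_img c) by exact: chart_img_open.
  have := Ck_onD oc (sf c cA k) (Ck_onM oc (Ck_on_cst k (-1 : R^o) oc) (sg c cA k)).
  by apply: Ck_on_ext => // x _; rewrite !fctE /= mulN1r.
- apply: Ck_onM (sf c cA k) (sg c cA k).
  exact: chart_img_open.
Qed.

Lemma smooth_pred_submod : submod_closed smooth_pred.
Proof.
split=> [|a f g /asboolP sf /asboolP sg]; apply/asboolP => c cA k.
  by apply: Ck_on_cst; exact: chart_img_open.
have oc : open (chart_img c) by exact: chart_img_open.
exact: Ck_onD oc (Ck_onM oc (Ck_on_cst k (a : R^o) oc) (sf c cA k)) (sg c cA k).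
Qed.

HB.instance Definition _ :=
  GRing.isSubringClosed.Build (M -> R^o) smooth_pred smooth_pred_subring.
HB.instance Definition _ := GRing.isSubmodClosed.Build R (M -> R^o) smooth_pred
  smooth_pred_submod.

Record Cinf := MkCinf {
  Cinf_fun :> M -> R;
  Cinf_smooth : Cinf_fun \in smooth_pred
}.

HB.instance Definition _ := [isSub of Cinf for (Cinf_fun : Cinf -> (M -> R^o))].
HB.instance Definition _ := [Choice of Cinf by <:].
HB.instance Definition _ := GRing.SubChoice_isSubComPzRing.Build _ _ Cinf smooth_pred_subring.
HB.instance Definition _ := [SubZmodule_isSubLmodule of Cinf by <:].

End SmoothFunctions.

Section VectorFields.
Context {R : realType} {n : nat} (M : manifold R n).
Local Notation C := (Cinf M).

Definition derivation (D : C -> C) : Prop :=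
  (forall (a : R) (f g : C), D (a *: f + g) = a *: D f + D g) /\
  (forall f g : C, D (f * g) = D f * g + f * D g).
Definition derivation_pred : {pred C -> C^o} := fun D => `[< derivation D >].

Lemma Cinf_scalerAl (a : R) (f g : C) : a *: (f * g) = (a *: f) * g.
Proof. by apply/val_inj/funext => p; exact: mulrA. Qed.

Lemma derivation_pred_submod : submod_closed derivation_pred.
Proof.
have scalerAr (a : R) (f g : C) : f * (a *: g) = a *: (f * g).
  by rewrite mulrC -Cinf_scalerAl mulrC.
split=> [|h D E /asboolP[Dl DM] /asboolP[El EM]]; apply/asboolP.
  split=> [a f g|f g].
    by rewrite [RHS]addr0; apply/esym/(scaler0 C a).
  by rewrite [RHS](_ : _ = 0 * g + f * 0) // mul0r mulr0 addr0.
split=> [a f g|f g].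
  transitivity (h * D (a *: f + g) + E (a *: f + g) : C) => //.
  by rewrite Dl El mulrDr scalerAr addrACA -scalerDr.
transitivity (h * D (f * g) + E (f * g) : C) => //.
rewrite DM EM mulrDr addrACA mulrDl mulrA; congr (_ + _).
by rewrite mulrDr; congr (_ + _); rewrite mulrCA.
Qed.

HB.instance Definition _ := GRing.isSubmodClosed.Build C (C -> C^o)
  derivation_pred derivation_pred_submod.

Record vfield := MkVfield {
  vfield_fun :> C -> C;
  vfieldP : vfield_fun \in derivation_pred
}.

(* vfield inherits its Cinf-module structure from Cinf -> Cinf, where C^o is
   Cinf seen as a module over itself. *)
HB.instance Definition _ := [isSub of vfield for (vfield_fun : vfield -> (C -> C^o))].
HB.instance Definition _ := [Choice of vfield by <:].
HB.instance Definition _ := [SubChoice_isSubLmodule of vfield by <:].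

Lemma bracket_derivation (X Y : vfield) :
  (fun f : C => X (Y f) - Y (X f)) \in derivation_pred.
Proof.
have /asboolP[Xl XM] := vfieldP X; have /asboolP[Yl YM] := vfieldP Y.
have XD u v : X (u + v) = X u + X v by have := Xl 1 u v; rewrite !scale1r.
have YD u v : Y (u + v) = Y u + Y v by have := Yl 1 u v; rewrite !scale1r.
apply/asboolP; split=> [a f g|f g].
  by rewrite Xl Yl Xl Yl opprD addrACA scalerBr.
by rewrite XM YM XD YD !XM !YM; ring.
Qed.

Definition bracket (X Y : vfield) : vfield := MkVfield (bracket_derivation X Y).

(* X does not vanish at p: the tangent vector f |-> (X f)(p) is nonzero. *)
Definition nonzero_at (X : vfield) (p : M) : Prop := exists f : C, X f p != 0.

End VectorFields.

Definition one_form (R : realType) (n : nat) (M : manifold R n) :=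
  {scalar vfield M}.
Definition endo_field (R : realType) (n : nat) (M : manifold R n) :=
  {linear vfield M -> vfield M}.

Section Tensors.
Context {R : realType} {n : nat} {M : manifold R n}.
Local Notation C := (Cinf M).
Local Notation V := (vfield M).

Implicit Types (a : one_form M) (X Y W Z : vfield M).

Definition dform a X Y : C :=
  (2%:R^-1 : R) *: (X (a Y) - Y (a X) - a (bracket X Y)).

(* Only used for wedge products of one-forms and of their differentials, which
   are alternating and Cinf-multilinear. *)
Definition form (k : nat) := ('I_k -> vfield M) -> Cinf M.

Definition form_of_one a : form 1 := fun Xs => a (Xs ord0).
Definition form_of_two (b : vfield M -> vfield M -> Cinf M) : form 2 :=
  fun Xs => b (Xs ord0) (Xs ord_max).

(* The factor 1/(k+l)! is the normalization compatible with the factor 1/2 in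
   dform. *)
Definition wedge k l (v : form k) (w : form l) : form (k + l) :=
  fun Xs => (((k + l)`!)%:R^-1 : R) *: \sum_(s : 'S_(k + l))
    (-1) ^+ s * v (fun i => Xs (s (lshift l i)))
              * w (fun j => Xs (s (rshift k j))).

(* [form] hides further arguments, which are not to become implicit. *)
Unset Implicit Arguments.
Fixpoint wedge_exp (w : form 2) (k : nat) : form k.*2 :=
  match k with
  | 0 => fun _ => 1
  | k'.+1 => wedge w (wedge_exp w k')
  end.
Set Implicit Arguments.

(* In degree n, w is a volume form. *)
Definition nowhere_zero k (w : form k) : Prop :=
  forall p : M, exists Xs, w Xs p != 0.

(* Type (0,0) is possible: on the plane, dx and dy with phi = 0 and the flat
   metric dx^2 + dy^2 form a normal decomposable metric contact pair. *)
Definition contact_pair (h k : nat) (a1 a2 : one_form M) : Prop :=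
  let da1 := form_of_two (dform a1) in
  let da2 := form_of_two (dform a2) in
  [/\ n = (2 * h + 2 * k + 2)%N,
      nowhere_zero (wedge (wedge (wedge (form_of_one a1) (wedge_exp da1 h))
                                 (form_of_one a2)) (wedge_exp da2 k)),
      (forall Xs, wedge_exp da1 h.+1 Xs = 0) &
      (forall Xs, wedge_exp da2 k.+1 Xs = 0)].

Definition reeb_fields (a1 a2 : one_form M) (Z1 Z2 : vfield M) : Prop :=
  [/\ a1 Z1 = 1, a1 Z2 = 0, a2 Z1 = 0 & a2 Z2 = 1] /\
  (forall X, [/\ dform a1 Z1 X = 0, dform a1 Z2 X = 0,
                dform a2 Z1 X = 0 & dform a2 Z2 X = 0]).

(* The Reeb vector fields, which a contact pair determines, are carried along
   as parameters. *)
Definition contact_pair_structure (h k : nat) (a1 a2 : one_form M)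
    (Z1 Z2 : vfield M) (phi : endo_field M) : Prop :=
  [/\ contact_pair h k a1 a2,
      reeb_fields a1 a2 Z1 Z2,
      (forall X, phi (phi X) = - X + a1 X *: Z1 + a2 X *: Z2),
      phi Z1 = 0 &
      phi Z2 = 0].

(* X is a section of the (constant rank) distribution ker a :&: ker da. *)
Definition in_char_foliation a X : Prop :=
  a X = 0 /\ forall Y, dform a X Y = 0.

Definition decomposable (a1 a2 : one_form M) (phi : endo_field M) : Prop :=
  (forall X, in_char_foliation a1 X -> in_char_foliation a1 (phi X)) /\
  (forall X, in_char_foliation a2 X -> in_char_foliation a2 (phi X)).

Definition nijenhuis (phi : endo_field M) X Y : V :=
  phi (phi (bracket X Y)) + bracket (phi X) (phi Y)
  - phi (bracket (phi X) Y) - phi (bracket X (phi Y)).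

Definition normal_pair (a1 a2 : one_form M) (Z1 Z2 : vfield M)
    (phi : endo_field M) : Prop :=
  forall X Y, nijenhuis phi X Y + (2%:R * dform a1 X Y) *: Z1
              + (2%:R * dform a2 X Y) *: Z2 = 0.

Definition riemannian_metric (g : vfield M -> vfield M -> Cinf M) : Prop :=
  [/\ (forall Y, scalar (g^~ Y)), (forall X Y, g X Y = g Y X) &
      (forall X p, nonzero_at X p -> 0 < g X X p)].

Definition associated (a1 a2 : one_form M) (Z1 Z2 : vfield M)
    (phi : endo_field M) (g : vfield M -> vfield M -> Cinf M) : Prop :=
  (forall X Y, g X (phi Y) = dform a1 X Y + dform a2 X Y) /\
  (forall X, g X Z1 = a1 X /\ g X Z2 = a2 X).

Definition affine_connection (nabla : vfield M -> vfield M -> vfield M) : Prop :=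
  [/\ (forall Y, linear (nabla^~ Y)),
      (forall X Y W, nabla X (Y + W) = nabla X Y + nabla X W) &
      (forall X (f : C) Y, nabla X (f *: Y) = X f *: Y + f *: nabla X Y)].

Definition levi_civita (g : vfield M -> vfield M -> Cinf M)
    (nabla : vfield M -> vfield M -> vfield M) : Prop :=
  [/\ affine_connection nabla,
      (forall X Y, nabla X Y - nabla Y X = bracket X Y) &
      (forall X Y W, X (g Y W) = g (nabla X Y) W + g Y (nabla X W))].

Definition curvature (nabla : vfield M -> vfield M -> vfield M) X Y W : V :=
  nabla X (nabla Y W) - nabla Y (nabla X W) - nabla (bracket X Y) W.

(* Every metric has exactly one Levi-Civita connection; nabla is that one. *)
Definition flat (g : vfield M -> vfield M -> Cinf M) : Prop :=
  exists2 nabla, levi_civita g nabla &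
    forall X Y W, curvature nabla X Y W = 0.

End Tensors.

(* Main.v *)
Require Import Defs.
From mathcomp Require Import all_boot all_order perm all_algebra.
From mathcomp Require Import all_classical all_reals all_analysis.
From mathcomp Require Import ring.
Import Order.TTheory GRing.Theory Num.Theory.
Local Open Scope classical_set_scope.
Local Open Scope ring_scope.

(** By normality the Reeb fields [Z1], [Z2] preserve [phi], hence also the
    metric, since it is determined by [da1 + da2], [phi], [a1] and [a2]. A
    Killing field [Z] of unit length with dual form [a] satisfies
    [g (nabla_X Z) Y = da X Y], and [R(X, Z) Z = - A^2 X] for the skew-symmetric
    [A X = nabla_X Z]. Flatness thus forces [A = 0], so that [da1 = da2 = 0],
    which is incompatible with the volume condition as soon as [h + k > 0]. *)

(** * Lie brackets, invariance of one-forms and their differentials, vanishing wedge products *)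

Section Calculus.
Set Implicit Arguments.
Unset Strict Implicit.
Context {R : realType} {n : nat} {M : manifold R n}.
Local Notation C := (Cinf M).
Local Notation V := (vfield M).
Implicit Types (a : one_form M) (X Y W Z : V) (u v f : C).

Lemma vfieldD X u v : X (u + v) = X u + X v.
Proof.
by have /asboolP[Xl _] := vfieldP X; have := Xl 1 u v; rewrite !scale1r.
Qed.

Lemma vfieldM X u v : X (u * v) = X u * v + u * X v.
Proof. by have /asboolP[_ XM] := vfieldP X. Qed.

Lemma vfield0 X : X 0 = 0.
Proof. by apply: (addrI (X 0)); rewrite -vfieldD !addr0. Qed.

Lemma vfieldN X u : X (- u) = - X u.
Proof. by apply: (addrI (X u)); rewrite -vfieldD !subrr vfield0. Qed.

Lemma vfieldB X u v : X (u - v) = X u - X v.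
Proof. by rewrite vfieldD vfieldN. Qed.

Lemma vfieldZ X (c : R) u : X (c *: u) = c *: X u.
Proof.
have /asboolP[Xl _] := vfieldP X.
by have := Xl c u 0; rewrite vfield0 !addr0.
Qed.

Lemma vfield1 X : X 1 = 0.
Proof.
by apply: (addrI (X 1)); rewrite addr0 -[in RHS](mulr1 1) vfieldM mulr1 mul1r.
Qed.

Lemma vfield_eq X Y : (forall u, X u = Y u) -> X = Y.
Proof. by move=> XY; apply/val_inj/funext. Qed.

Lemma add_vfieldE X Y u : (X + Y) u = X u + Y u.
Proof. by []. Qed.

Lemma opp_vfieldE X u : (- X) u = - X u.
Proof. by []. Qed.

Lemma scale_vfieldE f X u : (f *: X) u = f * X u.
Proof. by []. Qed.

Lemma bracketE X Y u : bracket X Y u = X (Y u) - Y (X u).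
Proof. by []. Qed.

Definition vfieldE := (add_vfieldE, opp_vfieldE, scale_vfieldE, bracketE).

Lemma bracketC X Y : bracket Y X = - bracket X Y.
Proof. by apply: vfield_eq => u; rewrite !vfieldE opprB. Qed.

Lemma bracketDr Z X Y : bracket Z (X + Y) = bracket Z X + bracket Z Y.
Proof. by apply: vfield_eq => u; rewrite !vfieldE vfieldD; ring. Qed.

Lemma bracketNr Z X : bracket Z (- X) = - bracket Z X.
Proof. by apply: vfield_eq => u; rewrite !vfieldE vfieldN; ring. Qed.

Lemma bracket0r Z : bracket Z 0 = 0.
Proof. by apply: (addrI (bracket Z 0)); rewrite -bracketDr !addr0. Qed.

Lemma bracketXX Z : bracket Z Z = 0.
Proof. by apply: vfield_eq => u; rewrite vfieldE subrr. Qed.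

Lemma bracketZr Z f X : bracket Z (f *: X) = Z f *: X + f *: bracket Z X.
Proof. by apply: vfield_eq => u; rewrite !vfieldE vfieldM; ring. Qed.

Lemma bracket_Jacobi Z X Y :
  bracket Z (bracket X Y) = bracket (bracket Z X) Y + bracket X (bracket Z Y).
Proof. by apply: vfield_eq => u; rewrite !vfieldE !vfieldB; ring. Qed.

Lemma half_eq0 u : (2%:R^-1 : R) *: u = 0 -> u = 0.
Proof.
move=> /(congr1 (fun w : C => (2%:R : R) *: w)).
by rewrite scalerA divff ?pnatr_eq0// scale1r scaler0.
Qed.

Lemma half_double u : (2%:R^-1 : R) *: (u + u) = u.
Proof.
by rewrite -[u + u](scaler_nat 2 u) scalerA mulVf ?scale1r// pnatr_eq0.
Qed.

(** Cartan's formula: the Lie derivative of [a] along [Z] is [d (a Z)] plus twice the contraction of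
    [dform a] with [Z], and both terms vanish. *)
Lemma dform_contract_eq0 a Z f : a Z = f -> (forall X, X f = 0) ->
  (forall X, dform a Z X = 0) -> forall X, Z (a X) = a (bracket Z X).
Proof.
move=> aZ f0 dZ X; have /half_eq0 := dZ X.
by rewrite aZ f0 subr0 => /subr0_eq.
Qed.

(** The Lie derivative commutes with [d], by the Jacobi identity; so a field preserving [a]
    preserves [dform a]. *)
Lemma lie_dform a Z X Y : (forall W, Z (a W) = a (bracket Z W)) ->
  Z (dform a X Y) = dform a (bracket Z X) Y + dform a X (bracket Z Y).
Proof.
move=> La; rewrite /dform vfieldZ -scalerDr; congr (_ *: _).
rewrite !vfieldB La bracket_Jacobi raddfD /= -!La.
by ring.
Qed.

Lemma wedge_eq0l i j (v : @Defs.form R n M i) (w : @Defs.form R n M j) :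
  (forall Xs, v Xs = 0) -> forall Xs, wedge v w Xs = 0.
Proof.
by move=> v0 Xs; rewrite /wedge big1 ?scaler0// => s _; rewrite v0 mulr0 mul0r.
Qed.

Lemma wedge_eq0r i j (v : @Defs.form R n M i) (w : @Defs.form R n M j) :
  (forall Xs, w Xs = 0) -> forall Xs, wedge v w Xs = 0.
Proof.
by move=> w0 Xs; rewrite /wedge big1 ?scaler0// => s _; rewrite w0 mulr0.
Qed.

(** The exponent must be positive because the zeroth power is the constant 1. *)
Lemma wedge_exp_eq0 (b : V -> V -> C) i :
  (forall X Y, b X Y = 0) -> (0 < i)%N ->
  forall Xs, wedge_exp (form_of_two b) i Xs = 0.
Proof.
case: i => // i b0 _.
exact: (@wedge_eq0l _ _ (form_of_two b) (wedge_exp (form_of_two b) i)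
          (fun=> b0 _ _)).
Qed.

End Calculus.

(** * Killing fields and the Levi-Civita connection *)

Section Metric.
Set Implicit Arguments.
Unset Strict Implicit.
Context {R : realType} {n : nat} {M : manifold R n}.
Local Notation V := (vfield M).
Variable g : V -> V -> Cinf M.
Hypothesis g_metric : riemannian_metric g.
Implicit Types (a : one_form M) (X Y W Z : V).

Lemma metricC X Y : g X Y = g Y X.
Proof. by case: g_metric. Qed.

Lemma metricDl X Y W : g (X + Y) W = g X W + g Y W.
Proof.
by have [gl _ _] := g_metric; have := gl W 1 X Y; rewrite scale1r mul1r.
Qed.

Lemma metric0l W : g 0 W = 0.
Proof. by apply: (addrI (g 0 W)); rewrite -metricDl !addr0. Qed.

Lemma metricZl f X W : g (f *: X) W = f * g X W.
Proof.
by have [gl _ _] := g_metric; have := gl W f X 0; rewrite metric0l !addr0.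
Qed.

Lemma metricNl X W : g (- X) W = - g X W.
Proof. by apply: (addrI (g X W)); rewrite -metricDl !subrr metric0l. Qed.

Lemma metricDr X Y W : g W (X + Y) = g W X + g W Y.
Proof. by rewrite !(metricC W) metricDl. Qed.

Lemma metricZr f X W : g W (f *: X) = f * g W X.
Proof. by rewrite !(metricC W) metricZl. Qed.

Lemma metricNr X W : g W (- X) = - g W X.
Proof. by rewrite !(metricC W) metricNl. Qed.

Lemma metric_eq0 X : g X X = 0 -> X = 0.
Proof.
have [_ _ gpos] := g_metric => gX0.
apply: vfield_eq => u; apply/val_inj/funext => p.
apply: contrapT => /eqP Xup.
by have := gpos X p (ex_intro _ u Xup); rewrite gX0 ltxx.
Qed.

Lemma metric_inj X Y : (forall W, g X W = g Y W) -> X = Y.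
Proof.
move=> XY; apply/subr0_eq/metric_eq0.
by rewrite metricDl metricNl XY subrr.
Qed.

Definition killing Z : Prop :=
  forall X Y, Z (g X Y) = g (bracket Z X) Y + g X (bracket Z Y).

Section LeviCivita.
Variable nabla : V -> V -> V.
Hypothesis nablaP : levi_civita g nabla.

Lemma nabla_torsion X Y : nabla X Y = bracket X Y + nabla Y X.
Proof. by have [_ <- _] := nablaP; rewrite subrK. Qed.

Lemma nabla_metric X Y W : X (g Y W) = g (nabla X Y) W + g Y (nabla X W).
Proof. by have [_ _] := nablaP. Qed.

Lemma nablaNl X Y : nabla (- X) Y = - nabla X Y.
Proof.
have [[nl _ _] _ _] := nablaP.
have n0 : nabla 0 Y = 0.
  apply: (addrI (nabla 0 Y)); have := nl Y 1 0 0.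
  by rewrite !scale1r !addr0 => <-.
by have := nl Y (-1) X 0; rewrite n0 !addr0 !scaleN1r.
Qed.

Lemma nabla0r X : nabla X 0 = 0.
Proof.
have [[_ nD _] _ _] := nablaP.
by apply: (addrI (nabla X 0)); rewrite -nD !addr0.
Qed.

(** Expand [Z (g X Y)] by metric compatibility and replace [nabla Z X] by [bracket Z X + nabla X Z],
    likewise for [Y]; the Killing equation cancels the brackets. *)
Lemma killing_skew Z X Y : killing Z -> g X (nabla Y Z) = - g (nabla X Z) Y.
Proof.
move=> ZK; have := ZK X Y.
rewrite nabla_metric !(nabla_torsion Z) metricDl metricDr => E.
apply: (addIr (g (nabla X Z) Y)); rewrite addNr.
apply: (addrI (g (bracket Z X) Y + g X (bracket Z Y))).
by rewrite addr0 -[RHS]E; ring.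
Qed.

(** With [a] written as [g _ Z], vanishing torsion reduces the bracket in [dform] to
    [g Y (nabla X Z) - g X (nabla Y Z)]. By skewness this is twice the left-hand side, and the
    factor 1/2 in [dform] absorbs the 2. *)
Lemma killing_nabla a Z X Y : killing Z -> (forall W, g W Z = a W) ->
  g (nabla X Z) Y = dform a X Y.
Proof.
move=> ZK aE; rewrite -[LHS]half_double /dform; congr (_ *: _).
rewrite -!aE !nabla_metric (nabla_torsion X Y) metricDl.
by rewrite (killing_skew X Y ZK) (metricC Y); ring.
Qed.

Lemma flat_killing_unit a Z : killing Z -> (forall W, g W Z = a W) ->
  a Z = 1 -> (forall X Y W, curvature nabla X Y W = 0) ->
  forall X Y, dform a X Y = 0.
Proof.
move=> ZK aE aZ flatR.
have La X : Z (a X) = a (bracket Z X).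
  by rewrite -!aE ZK bracketXX (metricC X) metric0l addr0.
have AE X Y : g (nabla X Z) Y = dform a X Y by exact: killing_nabla.
(* Unit length and invariance of [a] give this; hence [Z] is geodesic. *)
have dZ X : dform a Z X = 0.
  by rewrite /dform aZ vfield1 La subr0 subrr scaler0.
have AZ : nabla Z Z = 0 by apply: metric_inj => Y; rewrite AE dZ metric0l.
(* [Z] preserves both [g] and [dform a], hence also the endomorphism [A] relating them. *)
have LA X : bracket Z (nabla X Z) = nabla (bracket Z X) Z.
  apply: metric_inj => Y; rewrite AE.
  apply: (addIr (g (nabla X Z) (bracket Z Y))).
  by rewrite -ZK !AE (lie_dform _ _ La).
(* In [R(X, Z) Z], vanishing torsion turns [nabla Z (A X)] into [A (bracket Z X) + A (A X)]; the
   first term cancels against [A (bracket X Z)]. *)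
have A2 X : nabla (nabla X Z) Z = 0.
  have := flatR X Z Z; rewrite /curvature AZ nabla0r sub0r.
  rewrite (nabla_torsion Z) LA (bracketC Z X) nablaNl opprK opprD.
  by rewrite addrAC addNr add0r => /eqP; rewrite oppr_eq0 => /eqP.
move=> X Y; rewrite -AE (_ : nabla X Z = 0) ?metric0l//.
(* Skewness gives [g (A X) (A X) = - g (A (A X)) X]. *)
apply: metric_eq0; rewrite (killing_skew _ _ ZK) A2 metric0l.
exact: oppr0.
Qed.

End LeviCivita.
End Metric.

(** * Invariance properties of the Reeb fields *)

Section ContactPair.
Set Implicit Arguments.
Unset Strict Implicit.
Context {R : realType} {n : nat} {M : manifold R n}.
Local Notation V := (vfield M).
Variables (h k : nat) (a1 a2 : one_form M) (Z1 Z2 : V) (phi : endo_field M).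
Hypothesis cps : contact_pair_structure h k a1 a2 Z1 Z2 phi.
Implicit Types (X Y W Z : V).

(** Computing [phi (phi (phi X))] in two ways leaves [a1 (phi X) *: Z1 + a2 (phi X) *: Z2 = 0], to
    which [a1] and [a2] are applied. *)
Lemma contact_phi X : a1 (phi X) = 0 /\ a2 (phi X) = 0.
Proof.
have [_ [[a11 a12 a21 a22] _] phi2 phi1 phiZ2] := cps.
have : phi (phi (phi X)) = - phi X.
  rewrite (phi2 X) !raddfD raddfN /= !linearZ_LR /= phi1 phiZ2.
  by rewrite !scaler0 !addr0.
rewrite phi2 -addrA -[RHS]addr0 => /addrI E.
have E1 := congr1 a1 E; have E2 := congr1 a2 E.
move: E1 E2; rewrite !raddfD !raddf0 /= !linearZ_LR /= a11 a12 a21 a22.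
by rewrite !mulr1 !mulr0 addr0 add0r => -> ->.
Qed.

Lemma contact_ker_phi X : phi X = 0 -> a1 X = 0 -> a2 X = 0 -> X = 0.
Proof.
have [_ _ phi2 _ _] := cps => p0 e1 e2.
have := phi2 X; rewrite p0 raddf0 e1 e2 !scale0r !addr0 => /eqP.
by rewrite eq_sym oppr_eq0 => /eqP.
Qed.

Lemma reeb_invariant_form Z : Z = Z1 \/ Z = Z2 -> forall X,
  Z (a1 X) = a1 (bracket Z X) /\ Z (a2 X) = a2 (bracket Z X).
Proof.
have [_ [[a11 a12 a21 a22] dZ] _ _ _] := cps.
case=> -> X; split.
- apply: (dform_contract_eq0 a11 _ _) => W; [exact: vfield1|by have [] := dZ W].
- apply: (dform_contract_eq0 a21 _ _) => W; [exact: vfield0|by have [] := dZ W].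
- apply: (dform_contract_eq0 a12 _ _) => W; [exact: vfield0|by have [] := dZ W].
- apply: (dform_contract_eq0 a22 _ _) => W; [exact: vfield1|by have [] := dZ W].
Qed.

Hypothesis normal : normal_pair a1 a2 Z1 Z2 phi.

(** As [phi Z = 0] and [Z] contracts both differentials to zero, normality at [(Z, X)] says that
    [phi] kills [phi (bracket Z X) - bracket Z (phi X)]. Both one-forms kill it too, since they are
    invariant and vanish on the image of [phi]. *)
Lemma reeb_invariant_phi Z : Z = Z1 \/ Z = Z2 -> forall X,
  bracket Z (phi X) = phi (bracket Z X).
Proof.
move=> ZZ X; have [_ [_ dZ] _ phi1 phi2] := cps.
have pZ : phi Z = 0 by case: ZZ => ->.
have d1 : dform a1 Z X = 0 by have [] := dZ X; case: ZZ => ->.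
have d2 : dform a2 Z X = 0 by have [] := dZ X; case: ZZ => ->.
have := normal Z X.
rewrite d1 d2 !mulr0 !scale0r !addr0 /nijenhuis pZ.
rewrite (bracketC (phi X) 0) (bracketC X 0) !bracket0r oppr0 raddf0 subr0 addr0.
rewrite -raddfB => p0; apply/esym/subr0_eq/contact_ker_phi => //.
  have [e _] := reeb_invariant_form ZZ (phi X).
  by rewrite raddfB /= -e !(contact_phi _).1 vfield0 subr0.
have [_ e] := reeb_invariant_form ZZ (phi X).
by rewrite raddfB /= -e !(contact_phi _).2 vfield0 subr0.
Qed.

Lemma reeb_commute Z W : Z = Z1 \/ Z = Z2 -> W = Z1 \/ W = Z2 ->
  bracket Z W = 0.
Proof.
move=> ZZ WW; have [_ [[a11 a12 a21 a22] _] _ phi1 phi2] := cps.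
have [e1 e2] := reeb_invariant_form ZZ W.
apply: contact_ker_phi.
- rewrite -reeb_invariant_phi //.
  by case: WW => ->; rewrite ?phi1 ?phi2 bracket0r.
- by rewrite -e1; case: WW => ->; rewrite ?a11 ?a12 ?vfield1 ?vfield0.
- by rewrite -e2; case: WW => ->; rewrite ?a21 ?a22 ?vfield1 ?vfield0.
Qed.

Lemma reeb_killing g Z : riemannian_metric g ->
  associated a1 a2 Z1 Z2 phi g -> Z = Z1 \/ Z = Z2 -> killing g Z.
Proof.
move=> gm [gphi gZ] ZZ.
have [_ _ phi2 _ _] := cps.
have La1 X := (reeb_invariant_form ZZ X).1.
have La2 X := (reeb_invariant_form ZZ X).2.
have Kphi X Y : Z (g X (phi Y)) =
    g (bracket Z X) (phi Y) + g X (bracket Z (phi Y)).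
  rewrite (reeb_invariant_phi ZZ) !gphi vfieldD (lie_dform _ _ La1).
  by rewrite (lie_dform _ _ La2) addrACA.
have K1 X f : Z (g X (f *: Z1)) =
    g (bracket Z X) (f *: Z1) + g X (bracket Z (f *: Z1)).
  rewrite bracketZr (reeb_commute ZZ (or_introl erefl)) scaler0 addr0.
  by rewrite !(metricZr gm) !(gZ _).1 vfieldM La1 addrC.
have K2 X f : Z (g X (f *: Z2)) =
    g (bracket Z X) (f *: Z2) + g X (bracket Z (f *: Z2)).
  rewrite bracketZr (reeb_commute ZZ (or_intror erefl)) scaler0 addr0.
  by rewrite !(metricZr gm) !(gZ _).2 vfieldM La2 addrC.
move=> X Y.
(* On each of these summands [associated] expresses [g X _] through [dform a1 + dform a2], [a1] or
   [a2], all invariant under [Z]. *)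
have -> : Y = - phi (phi Y) + a1 Y *: Z1 + a2 Y *: Z2.
  by rewrite phi2 !opprD opprK addrAC !subrK.
rewrite !bracketDr bracketNr !(metricDr gm) !(metricNr gm) !vfieldD vfieldN.
by rewrite K1 K2 Kphi; ring.
Qed.

(** One of the two exponents is positive, so a zero factor enters the volume form, contradicting its
    nonvanishing at a point. *)
Lemma contact_not_closed : [set: M] !=set0 -> (0 < h + k)%N ->
  (forall X Y, dform a1 X Y = 0) -> (forall X Y, dform a2 X Y = 0) -> False.
Proof.
have [[_ vol _ _] _ _ _ _] := cps.
move=> [p _] hk0 d1 d2.
have [Xs /eqP] := vol p; apply; rewrite (_ : wedge _ _ Xs = 0)//.
move: hk0; rewrite addn_gt0 => /orP[h0|k0].
  do 2!apply: wedge_eq0l => ?.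
  by apply: wedge_eq0r; exact: wedge_exp_eq0.
by apply: wedge_eq0r; exact: wedge_exp_eq0.
Qed.

End ContactPair.

Theorem corollary4p4 (R : realType) (n : nat) (M : manifold R n)
    (M_nonempty : [set: M] !=set0) (h k : nat) (hk_gt0 : (0 < h + k)%N)
    (a1 a2 : one_form M) (Z1 Z2 : vfield M) (phi : endo_field M)
    (g : vfield M -> vfield M -> Cinf M) :
  contact_pair_structure h k a1 a2 Z1 Z2 phi ->
  decomposable a1 a2 phi ->
  normal_pair a1 a2 Z1 Z2 phi ->
  riemannian_metric g ->
  associated a1 a2 Z1 Z2 phi g ->
  ~ flat g.
Proof.
move=> cps _ normal gm assoc [nabla nablaP R0].
have [_ [[a11 _ _ a22] _] _ _ _] := cps.
(* Both forms are closed because each Reeb field is Killing, is dual to its form, and has unit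
   length by [a11] or [a22]. *)
apply: (contact_not_closed cps M_nonempty hk_gt0).
  apply: (flat_killing_unit gm nablaP _ _ a11 R0).
    exact: (reeb_killing cps normal gm assoc (or_introl erefl)).
  by move=> W; case: (assoc.2 W).
apply: (flat_killing_unit gm nablaP _ _ a22 R0).
  exact: (reeb_killing cps normal gm assoc (or_intror erefl)).
by move=> W; case: (assoc.2 W).
Qed.
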